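(* There is $p=O(\log^2 n)$ such that $D^{p}(\textsc{IndSub}(P_4))=\tilde O(n)$.
   Context: $P_4$ is the path on four vertices. Insertion-only streaming model: the edges of an $n$-vertex undirected input graph $G$ arrive as a stream in arbitrary order; the algorithm knows $n$, makes $p$ passes, and has $S$ bits of memory. $\textsc{IndSub}(H)$: decide whether $G$ contains $H$ as an induced subgraph and if so output the vertex set of a copy. $D^p(\Pi)$ is the minimum space of a deterministic $p$-pass streaming algorithm solving $\Pi$. $\tilde O$ hides polylogarithmic factors in $n$. *)

(* Defs.v *)
From mathcomp Require Import all_boot.
Set Implicit Arguments. Unset Strict Implicit. Unset Printing Implicit Defensive.

(* An edge of an n-vertex graph is an unordered pair {u,v}, i.e. a 2-element set. *)
Notation edge n := {set 'I_n} (only parsing).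

Definition valid_stream (n : nat) (s : seq (edge n)) : bool :=
  all (fun e : {set 'I_n} => #|e| == 2) s && uniq s.

Definition stream_adj (n : nat) (s : seq (edge n)) (u v : 'I_n) : bool :=
  [set u; v] \in s.

Definition induced_P4 (n : nat) (adj : 'I_n -> 'I_n -> bool) (X : {set 'I_n}) : Prop :=
  exists a b c d : 'I_n,
    [/\ X = [set a; b; c; d], #|X| = 4,
        [&& adj a b, adj b c & adj c d] &
        [&& ~~ adj a c, ~~ adj b d & ~~ adj a d]].

(* A deterministic streaming algorithm for n-vertex graphs with S bits of memory:
   the whole memory is an S-bit string; it starts in a fixed state, updates its
   memory on each stream item (the update may depend on the current pass number),
   memory persists between passes, and the output is a function of the final memory. *)
Record streamAlg (n S : nat) := StreamAlg {
  sa_init : S.-tuple bool;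
  sa_step : nat -> S.-tuple bool -> edge n -> S.-tuple bool;
  sa_out  : S.-tuple bool -> option {set 'I_n} }.

Definition run_passes (n S : nat) (A : streamAlg n S) (p : nat) (s : seq (edge n))
  : S.-tuple bool :=
  iteri p (fun i st => foldl (sa_step A i) st s) (sa_init A).

Definition solves_IndSub_P4 (n S : nat) (A : streamAlg n S) (p : nat) : Prop :=
  forall s : seq (edge n), valid_stream s ->
    match sa_out A (run_passes A p s) with
    | Some X => induced_P4 (stream_adj s) X
    | None => forall X, ~ induced_P4 (stream_adj s) X
    end.

(* D^p(IndSub(P_4)) <= B on n-vertex graphs: some deterministic p-pass algorithm
   with at most B bits of memory solves the problem (the minimum space is <= B). *)
Definition Dspace_IndSub_P4_le (n p B : nat) : Prop :=
  exists S, S <= B /\ exists A : streamAlg n S, solves_IndSub_P4 A p.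

(* Main.v *)
Require Import Defs.
From mathcomp Require Import all_boot.
From mathcomp Require Import zify.

(* A P4-free graph on at least two vertices has a pair of twins, so twin elimination codes the
   P4-free graphs on n vertices, even together with one further vertex of arbitrary neighbourhood,
   in O(n log n) bits. By a union bound over pairs of codes there is a fixed family of O(n log n) sets
   of edges such that the numbers of input edges in these sets, all counted in a single pass,
   determine the graph if it has a code. A second pass checks by counting whether
   the decoded graph is the input graph. A binary search then finds i such that the graph on
   the first i vertices is P4-free and the graph on the first i + 1 is not; the latter has a code,
   so one more pass reveals it, and with it an induced P4. *)

Set Implicit Arguments. Unset Strict Implicit. Unset Printing Implicit Defensive.

(** * Decomposition of P4-free graphs and existence of twins *)

Section Cographs.
Variables (V : finType) (g : rel V).
Hypothesis gC : symmetric g.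
Implicit Types (A B C : {set V}).

(** Colour [false] stands for non-edges, so a graph and its complement are treated alike. *)
Definition no_P4_of_color (b : bool) := forall x y z w, uniq [:: x; y; z; w] ->
  ~~ [&& g x y == b, g y z == b, g z w == b, g x z != b, g y w != b & g x w != b].

Lemma eqbN (b c : bool) : (b == ~~ c) = (b != c).
Proof. by case: b c => [] []. Qed.

(* P4 is self-complementary: if [x y z w] is a path in the complement,
   then [y w x z] is a path in the graph. *)
Lemma no_P4_of_colorN b : no_P4_of_color b -> no_P4_of_color (~~ b).
Proof.
move=> H x y z w U; have : uniq [:: y; w; x; z].
  by rewrite (perm_uniq (_ : perm_eq _ [:: x; y; z; w])) //; apply/permP => a /=; lia.
move/H; apply: contra; rewrite !eqbN !negbK => /and5P[xy yz zw xz /andP[yw xw]].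
by rewrite (gC w x) (gC w z) (gC y x) yw xw xz xy yz zw.
Qed.

(** A disjoint union for [b = false], a join for [b = true]. *)
Definition splits A := exists B C b, [/\ B != set0, C != set0, A = B :|: C,
  [disjoint B & C] & {in B & C, forall x y, g x y = b}].

(** If [v] has colour [b] to all of [C], it moves into [B]. Otherwise the set [M] of its
    [b]-neighbours in [B] splits off from everything else, unless some [x] in [B :\: M] and [w] in
    [M] lack colour [b]. *)
Lemma splits_add_vertex B C b v : (forall b', no_P4_of_color b') ->
  B != set0 -> C != set0 -> [disjoint B & C] -> v \notin B -> v \notin C ->
  {in B & C, forall x y, g x y = b} ->
  (exists2 y, y \in B & g v y = b) -> splits (v |: (B :|: C)).
Proof.
move=> H Bn Cn dBC vB vC bBC [y yB vy].
case: (boolP [forall z in C, g v z == b]) => [/forall_inP vCb | ].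
  exists (v |: B), C, b; split=> //.
  - by apply/set0Pn; exists v; rewrite setU11.
  - by rewrite setUA.
  - rewrite disjoint_sym disjoints_subset; apply/subsetP=> z zC.
    rewrite !inE negb_or; apply/andP; split.
      by apply: contraNneq vC => <-.
    by rewrite (disjointFl dBC zC).
  - move=> x z; rewrite !inE => /orP[/eqP-> /vCb/eqP //|]; exact: bBC.
case/forall_inPn=> z zC vz.
pose M := [set x in B | g v x == b].
case: (boolP [forall x in B :\: M, forall u in M, g x u == b]) => [/forall_inP MM|].
  exists M, (v |: ((B :\: M) :|: C)), b; split.
  - by apply/set0Pn; exists y; rewrite !inE yB vy eqxx.
  - by apply/set0Pn; exists v; rewrite setU11.
  - by apply/setP=> x; rewrite !inE; case: (x == v); case: (x \in B); case: (x \in C); case: (g v x == b).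
  - rewrite disjoints_subset; apply/subsetP=> x; rewrite !inE => /andP[xB ->].
    rewrite xB (disjointFr dBC xB) /= ?orbF.
    by apply: contraNneq vB => <-.
  - move=> x w xM; rewrite in_setU1 in_setU; case/or3P=> [/eqP->|wM|wC].
    + by move: xM; rewrite inE gC => /andP[_ /eqP].
    + by rewrite gC; apply/eqP; move/forall_inP: (MM _ wM); apply.
    + by apply: bBC => //; move: xM; rewrite inE => /andP[].
case/forall_inPn=> x; rewrite !inE => /andP[+ xB]; rewrite xB /= => vx.
case/forall_inPn=> w; rewrite !inE => /andP[wB /eqP vw] xw.
have zx : g z x = b by rewrite gC bBC.
have zw : g z w = b by rewrite gC bBC.
(* The path [z v x w] is induced in colour [~~ b], which is forbidden. *)
have U : uniq [:: z; v; x; w].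
  have ne (u1 u2 : V) (S : {set V}) : u1 \notin S -> u2 \in S -> u1 != u2.
    by move=> ? ?; apply: contraNneq (_ : u1 \notin S) => // ->.
  have zB : z \notin B by rewrite (disjointFl dBC zC).
  have zv : z != v by rewrite eq_sym (ne _ _ _ vC zC).
  rewrite /= !inE !negb_or zv (ne _ _ _ zB xB) (ne _ _ _ zB wB) (ne _ _ _ vB xB).
  rewrite (ne _ _ _ vB wB) !andbT /=; apply/eqP=> xw'.
  by move: vx; rewrite xw' vw eqxx.
move: (H (~~ b) _ _ _ _ U); rewrite !eqbN !negbK (gC z v) vz vx xw zx vw zw.
by rewrite !eqxx.
Qed.

(** Remove a vertex [v] and split the rest with colour [b]. If [v] has no [b]-neighbour there, it
    splits off alone with colour [~~ b]; otherwise [splits_add_vertex] applies. *)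
Lemma P4_free_splits A : (forall b, no_P4_of_color b) -> 1 < #|A| -> splits A.
Proof.
move=> H; elim: {A}_.+1 {-2}A (ltnSn #|A|) => // k IH A Ak A1.
have /card_gt0P[v vA] : 0 < #|A| by apply: ltnW.
have cA := cardsD1 v A; rewrite vA add1n in cA.
have EA : A = v |: (A :\ v) by rewrite setD1K.
case: (ltnP 1 #|A :\ v|) => A'; last first.
  exists [set v], (A :\ v).
  have /eqP/cards1P[w Ew] : #|A :\ v| = 1 by lia.
  exists (g v w); split=> //.
  - by apply/set0Pn; exists v; rewrite inE.
  - by rewrite Ew; apply/set0Pn; exists w; rewrite inE.
  - by rewrite disjoints1 !inE eqxx.
  - by rewrite Ew=> x y /set1P-> /set1P->.
have [] := IH (A :\ v) _ A'; first by lia.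
move=> B [C] [b] [Bn Cn EBC dBC bBC].
have vBC : v \notin B :|: C by rewrite -EBC !inE eqxx.
move: (vBC); rewrite inE negb_or => /andP[vB vC].
rewrite EA EBC.
case: (boolP [exists y in B, g v y == b]) => [/exists_inP[y yB /eqP vy]|nB].
  by apply: (splits_add_vertex H Bn Cn dBC vB vC bBC); exists y.
case: (boolP [exists y in C, g v y == b]) => [/exists_inP[y yC /eqP vy]|nC].
  rewrite setUC; rewrite setUC (setUC B); apply: (@splits_add_vertex _ _ b) => //.
  - by rewrite disjoint_sym.
  - by move=> x z xC zB; rewrite gC bBC.
  - by exists y.
exists [set v], (B :|: C), (~~ b); split=> //.
- by apply/set0Pn; exists v; rewrite inE.
- by case/set0Pn: Bn => y yB; apply/set0Pn; exists y; rewrite inE yB.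
- by rewrite disjoints1.
- move=> x y /set1P->; rewrite inE => /orP[yB|yC].
    by apply/eqP; rewrite eqbN; move/exists_inPn: nB; apply.
  by apply/eqP; rewrite eqbN; move/exists_inPn: nC; apply.
Qed.

(** Twins inside one part of a split are twins in [A], since each vertex of the other part sees both
    in the same colour. Two singleton parts are twins vacuously. *)
Lemma P4_free_twins A : (forall b, no_P4_of_color b) -> 1 < #|A| ->
  exists v w, [/\ v \in A, w \in A, v != w &
    {in A, forall x, x != v -> x != w -> g x v = g x w}].
Proof.
move=> H; elim: {A}_.+1 {-2}A (ltnSn #|A|) => // k IH A Ak A1.
have [B [C [b [Bn Cn EA dBC bBC]]]] := P4_free_splits H A1.
have cA : #|A| = #|B| + #|C| by rewrite EA; apply/eqP; rewrite (leq_card_setU B C).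
have B0 : 0 < #|B| by rewrite card_gt0.
have C0 : 0 < #|C| by rewrite card_gt0.
case: (ltnP 1 #|B|) => B1.
  have [|v [w [vB wB vw tw]]] := IH B _ B1; first by lia.
  exists v, w; rewrite EA !inE vB wB; split=> // x; rewrite inE => /orP[/tw //|xC] _ _.
  by rewrite !(gC x) !bBC.
case: (ltnP 1 #|C|) => C1.
  have [|v [w [vB wB vw tw]]] := IH C _ C1; first by lia.
  exists v, w; rewrite EA !inE vB wB !orbT; split=> // x; rewrite inE => /orP[xB|/tw //] _ _.
  by rewrite !bBC.
have /eqP/cards1P[v Ev] : #|B| = 1 by lia.
have /eqP/cards1P[w Ew] : #|C| = 1 by lia.
exists v, w; rewrite EA Ev Ew !inE !eqxx orbT; split=> //.
  by move: dBC; rewrite Ev Ew disjoints1 inE.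
by move=> x; rewrite !inE => /orP[]->.
Qed.

End Cographs.

(** * Coding P4-free graphs by twin elimination *)

Section TwinCodes.
Variable (V : finType).

(* [(v, w, b) :: l] adds [v] to the graph coded by [l] as a twin of [w], adjacent to [w] iff [b]. *)
Fixpoint twin_graph (l : seq (V * V * bool)) : rel V :=
  if l is (v, w, b) :: l' then fun x y =>
    if x == y then false
    else if x == v then if y == w then b else twin_graph l' w y
    else if y == v then if x == w then b else twin_graph l' x w
    else twin_graph l' x y
  else fun _ _ => false.

Lemma P4_free_twin_graph (g : rel V) (A : {set V}) :
  symmetric g -> irreflexive g -> (forall b, no_P4_of_color g b) ->
  exists2 l, size l = #|A| & {in A &, twin_graph l =2 g}.
Proof.
move=> gC gI H; elim: {A}_.+1 {-2}A (ltnSn #|A|) => // k IH A Ak.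
case: (ltnP 1 #|A|) => A1; last first.
  have [/eqP|A0] := posnP #|A|.
    by rewrite cards_eq0 => /eqP->; exists [::]; rewrite ?cards0 // => x y; rewrite inE.
  have /eqP/cards1P[v ->] : #|A| = 1 by lia.
  (* A dummy entry without edges keeps the code length equal to [#|A|]. *)
  exists [:: (v, v, false)]; rewrite ?cards1 // => x y /set1P-> /set1P->.
  by rewrite /= eqxx gI.
have [v [w [vA wA vw tw]]] := P4_free_twins gC H A1.
have cA := cardsD1 v A; rewrite vA add1n in cA.
have [|l sl El] := IH (A :\ v); first by lia.
exists ((v, w, g v w) :: l) => [|x y xA yA]; first by rewrite /= sl cA.
rewrite /=; case: (eqVneq x y) => [->|xy]; first by rewrite gI.
have wAv : w \in A :\ v by rewrite !inE eq_sym vw.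
case: (eqVneq x v) => [xv|xv].
  have yv : y != v by rewrite -xv eq_sym.
  case: (eqVneq y w) => [->|yw]; first by rewrite xv.
  by rewrite El // ?inE ?yv // xv !(gC _ y) tw.
case: (eqVneq y v) => [yv|yv].
  case: (eqVneq x w) => [->|xw]; first by rewrite yv gC.
  by rewrite El // ?inE ?xv // yv tw.
by rewrite El // !inE ?xv ?yv.
Qed.

End TwinCodes.

(** * Set families whose intersection counts separate given sets *)

Section SeparatingFamily.
Variable T : finType.
Implicit Types F G Q : {set T}.

(* Toggling a point of the symmetric difference of [F] and [G] maps the sets that do not
   separate [F] from [G] injectively to sets that do. *)
Lemma unseparating_sets_half F G : F != G ->
  2 * #|[set Q | #|F :&: Q| == #|G :&: Q|]| <= 2 ^ #|T|.
Proof.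
wlog [t tF tG] : F G / exists2 t, t \in F & t \notin G.
  move=> W FG; case: (boolP (F \subset G)) => [FsG|/subsetPn]; last by move/W; apply.
  case: (boolP (G \subset F)) => [GsF|/subsetPn E].
    by rewrite eqEsubset FsG GsF in FG.
  under eq_finset => Q do rewrite eq_sym.
  by apply: W => //; rewrite eq_sym.
move=> _; set X := [set Q | _].
pose f Q := if t \in Q then Q :\ t else t |: Q.
have fK : cancel f f.
  move=> Q; rewrite /f; case: (boolP (t \in Q)) => tQ.
    by rewrite !inE eqxx /= setD1K.
  by rewrite !inE eqxx /= setU1K.
have fX : [disjoint X & f @: X].
  rewrite disjoint_sym disjoints_subset; apply/subsetP=> _ /imsetP[Q + ->].
  rewrite !inE /f => /eqP E; apply/negP => /eqP.
  have key (R : {set T}) : t \notin R ->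
      (#|F :&: (t |: R)| = #|F :&: R|.+1) * (#|G :&: (t |: R)| = #|G :&: R|).
    move=> tR; split; rewrite setIUr.
      have -> : F :&: [set t] = [set t].
        by apply/setIidPr; rewrite sub1set.
      by rewrite cardsU1 inE (negbTE tR) andbF.
    have -> : G :&: [set t] = set0.
      by apply/setP=> x; rewrite !inE; case: eqVneq => [->|]; rewrite ?(negbTE tG) // andbF.
    by rewrite set0U.
  case: (boolP (t \in Q)) => tQ E'.
    have tR : t \notin Q :\ t by rewrite !inE eqxx.
    by move: E; rewrite -{1 2}(setD1K tQ) !key // E'; lia.
  by move: E'; rewrite !key // E; lia.
rewrite mul2n -addnn -{2}(card_imset X (can_inj fK)).
have -> : #|X| + #|f @: X| = #|X :|: f @: X|.
  by apply/esym/eqP; rewrite (leq_card_setU X (f @: X)).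
by rewrite -(cardsT T) -card_powerset powersetT subset_leq_card ?subsetT.
Qed.

(** Each pair with distinct sets is left unseparated by at most a [1 / 2 ^ m] fraction of all
    families, and there are fewer than [2 ^ m] pairs. *)
Lemma separating_family (I : finType) (D : I -> {set T}) m : #|I| ^ 2 < 2 ^ m ->
  exists Q : 'I_m -> {set T}, forall i i',
    (forall j, #|D i :&: Q j| = #|D i' :&: Q j|) -> D i = D i'.
Proof.
move=> Im.
pose X F G := [set Q | #|F :&: Q| == #|G :&: Q|].
pose bad (p : I * I) := [set Q : {ffun 'I_m -> {set T}} | Q \in ffun_on (mem (X (D p.1) (D p.2)))].
case: (boolP [exists Q : {ffun 'I_m -> {set T}},
  [forall p : I * I, (D p.1 != D p.2) ==> (Q \notin bad p)]]).
  case/existsP=> Q /forallP HQ; exists Q => i i' E; apply/eqP/negPn/negP=> ne.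
  move: (HQ (i, i')) => /implyP/(_ ne); rewrite inE => /negP; apply.
  by apply/ffun_onP => j; rewrite inE E.
move=> nex; exfalso.
have : #|{ffun 'I_m -> {set T}}| * 2 ^ m <= #|I| ^ 2 * #|{ffun 'I_m -> {set T}}|.
  have cov : [set: {ffun 'I_m -> {set T}}] \subset
             \bigcup_(p : I * I | D p.1 != D p.2) bad p.
    apply/subsetP=> Q _; move/existsPn/(_ Q): nex; rewrite negb_forall => /existsP[p].
    by rewrite negb_imply negbK => /andP[ne Qb]; apply/bigcupP; exists p.
  have bd p : D p.1 != D p.2 -> #|bad p| * 2 ^ m <= #|{ffun 'I_m -> {set T}}|.
    move=> ne; rewrite cardsE card_ffun_on card_ffun card_ord -expnMn.
    have le : #|X (D p.1) (D p.2)| * 2 <= #|{set T}|.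
      rewrite mulnC (leq_trans (unseparating_sets_half ne)) //.
      by rewrite -(cardsT T) -card_powerset max_card.
    by case: (posnP m) => [->|m0]; rewrite ?expn0 ?leq_exp2r.
  rewrite -[X in X * _ <= _]cardsT.
  apply: leq_trans (leq_mul (subset_leq_card cov) (leqnn _)) _.
  have bc : #|\bigcup_(p : I * I | D p.1 != D p.2) bad p| <= \sum_(p | D p.1 != D p.2) #|bad p|.
    elim/big_rec2: _ => [|p k X' _ IH]; first by rewrite cards0.
    by apply: leq_trans (leq_card_setU _ _) _; rewrite leq_add2l.
  apply: leq_trans (leq_mul bc (leqnn _)) _.
  rewrite big_distrl /= -mulnn -card_prod -sum_nat_const.
  rewrite [leqRHS](bigID (fun p : I * I => D p.1 != D p.2)) /=.
  by apply: leq_trans (leq_addr _ _); apply: leq_sum.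
rewrite mulnC leq_pmul2r; first by rewrite leqNgt Im.
by apply/card_gt0P; exists [ffun=> set0].
Qed.

End SeparatingFamily.

(** * Finite machines as streaming algorithms *)

Section Machines.
Variables (n : nat) (M : finType) (init : M) (step : nat -> M -> {set 'I_n} -> M)
  (out : M -> option {set 'I_n}).

Lemma streamAlg_of_machine S : #|M| <= 2 ^ S ->
  exists A : streamAlg n S, forall p s,
    sa_out A (run_passes A p s) = out (iteri p (fun i st => foldl (step i) st s) init).
Proof.
move=> MS.
have cT : #|{: S.-tuple bool}| = 2 ^ S by rewrite card_tuple card_bool.
have MT : #|M| <= #|{: S.-tuple bool}| by rewrite cT.
pose enc x : S.-tuple bool := enum_val (widen_ord MT (enum_rank x)).
have encI : injective enc.
  by move=> x y /enum_val_inj/(congr1 val)/= /ord_inj/enum_rank_inj.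
(* The default [init] matters only outside the image of [enc], which a run never leaves. *)
pose dec y := odflt init [pick x | enc x == y].
have encK : cancel enc dec.
  move=> x; rewrite /dec; case: pickP => [y /eqP/encI //|/(_ x)]; by rewrite eqxx.
exists (StreamAlg (enc init) (fun i y e => enc (step i (dec y) e)) (fun y => out (dec y))) => p s.
rewrite /run_passes /=.
suff -> : iteri p (fun i st => foldl (fun y e => enc (step i (dec y) e)) st s) (enc init)
   = enc (iteri p (fun i st => foldl (step i) st s) init) by rewrite encK.
elim: p => //= p ->; elim: s (iteri _ _ _) => //= e s IH x.
by rewrite encK IH.
Qed.
End Machines.

Lemma size_valid_stream n (s : seq {set 'I_n}) : valid_stream s -> size s <= n ^ 2.
Proof.
case/andP=> s2 us.
have : size s <= #|[set e : {set 'I_n} | #|e| == 2]|.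
  rewrite -(card_uniqP us); apply/subset_leq_card/subsetP=> e es.
  by rewrite inE (allP s2).
move/leq_trans; apply; rewrite card_draws card_ord bin2.
by case: n {s s2 us} => // k; rewrite -divn2; apply: leq_trans (leq_div _ _) _; rewrite -mulnn leq_mul.
Qed.

(** * Streaming simulation of protocols that count edges in each pass *)

Section CountingProtocols.
Variables (n m P : nat) (D : finType) (d0 : D).
Variable query : nat -> D -> 'I_m -> {set {set 'I_n}}.
Variable digest : nat -> D -> {ffun 'I_m -> nat} -> D.
Variable out : D -> option {set 'I_n}.

Definition protocol_state (s : seq {set 'I_n}) t : D :=
  iteri t (fun i d => digest i d [ffun j => count (mem (query i d j)) s]) d0.

Local Notation counters := {ffun 'I_m -> 'I_(n ^ 2).+1}.
Local Notation memory := ('I_P.+1 * D * counters)%type.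

Definition count_item (Q : 'I_m -> {set {set 'I_n}}) (c : counters) e : counters :=
  [ffun j => inord (c j + (e \in Q j))].

Definition end_pass i d (c : counters) : D := digest i d [ffun j => val (c j)].

(* A streaming algorithm gets no signal at the end of a pass: the memory carries the number of the
   pass it was last updated in, and the first item of a pass triggers the digest of the previous one. *)
Definition protocol_step i (x : memory) e : memory :=
  let: (t, d, c) := if x.1.1 == i :> nat then x
    else (inord i, end_pass x.1.1 x.1.2 x.2, [ffun=> ord0]) in
  (t, d, count_item (query i d) c e).

Lemma foldl_protocol_step i (t : 'I_P.+1) d c s : t = i :> nat ->
  foldl (protocol_step i) (t, d, c) s = (t, d, foldl (count_item (query i d)) c s).
Proof. by move=> ti; elim: s c => //= e s IH c; rewrite /protocol_step /= ti eqxx IH. Qed.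

(** No count exceeds the stream length, so [inord] always receives a value in range. *)
Lemma foldl_count_item Q s j : size s <= n ^ 2 ->
  val (foldl (count_item Q) [ffun=> ord0] s j) = count (mem (Q j)) s.
Proof.
elim/last_ind: s => [|s e IH]; first by rewrite ffunE.
rewrite size_rcons -cats1 foldl_cat count_cat /= addn0 => sn.
rewrite ffunE IH ?(ltnW sn) // inordK // ltnS (leq_trans _ sn) //.
by rewrite -addn1 leq_add ?count_size ?leq_b1.
Qed.

(** After [t.+1] passes only [t] digests are done, the last one being still pending. The stream must
    be nonempty because an item triggers each digest. *)
Lemma run_protocol s t : s != [::] -> size s <= n ^ 2 -> t <= P ->
  iteri t.+1 (fun i => foldl (protocol_step i) ^~ s) (ord0, d0, [ffun=> ord0]) =
  (inord t, protocol_state s t,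
   foldl (count_item (query t (protocol_state s t))) [ffun=> ord0] s).
Proof.
move=> s0 sn; elim: t => [_|t IH tP].
  rewrite [iteri _ _ _]/= foldl_protocol_step //; congr (_, _, _).
  by apply: val_inj; rewrite /= inordK.
rewrite iteriS IH ?(ltnW tP) //.
case: s s0 sn {IH} => // e s _ sn; set c := foldl (count_item _) _ _.
have -> : foldl (protocol_step t.+1) (inord t, protocol_state (e :: s) t, c) (e :: s) =
  foldl (protocol_step t.+1) (inord t.+1, protocol_state (e :: s) t.+1, [ffun=> ord0]) (e :: s).
  rewrite [LHS]/= [RHS]/=; congr (foldl _ _ s).
  rewrite /protocol_step [_.1.1]/= [_.1.2]/= [_.2]/= !inordK ?ltnS // ?(ltnW tP) //.
  rewrite eqn_leq ltnn andbF eqxx.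
  suff -> : end_pass t (protocol_state (e :: s) t) c = protocol_state (e :: s) t.+1 by [].
  by congr digest; apply/ffunP=> j; rewrite !ffunE foldl_count_item.
by rewrite foldl_protocol_step // inordK.
Qed.

Lemma Dspace_of_protocol B : 0 < P ->
  P.+1 * #|D| * (n ^ 2).+1 ^ m <= 2 ^ B ->
  (forall s, valid_stream s -> match out (protocol_state s P.+1) with
    | Some X => induced_P4 (stream_adj s) X
    | None => forall X, ~ induced_P4 (stream_adj s) X end) ->
  Dspace_IndSub_P4_le n P.+1 B.
Proof.
move=> P0 MB correct; exists B; split=> //.
(* The output function makes the pending digest. On the empty stream the pass number stays [0],
   unlike [P], and the answer is [None]. *)
pose mout (x : memory) := if x.1.1 == P :> nat then out (end_pass P x.1.2 x.2) else None.
have [|A EA] := streamAlg_of_machine (ord0, d0, [ffun=> ord0] : counters) protocol_step mout (S := B).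
  by rewrite !card_prod card_ffun !card_ord.
exists A => s vs; rewrite EA.
have [->|s0] := eqVneq s [::].
  have noop k x : iteri k (fun i => foldl (protocol_step i) ^~ [::]) x = x by elim: k.
  rewrite noop.
  rewrite /mout /= eq_sym -leqn0 leqNgt P0 => X [a [b [c [d]]]].
  by rewrite /stream_adj !in_nil => -[].
have sn := size_valid_stream vs.
rewrite run_protocol // /mout /= inordK // eqxx.
have -> : end_pass P (protocol_state s P)
    (foldl (count_item (query P (protocol_state s P))) [ffun=> ord0] s) = protocol_state s P.+1.
  by congr digest; apply/ffunP=> j; rewrite !ffunE foldl_count_item.
exact: correct.
Qed.

End CountingProtocols.

(** * Edge sets, induced paths and vertex prefixes *)

Section EdgeSets.
Variable n : nat.
Implicit Types (E F : {set {set 'I_n}}) (v : 'I_n).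

Definition edge_adj F : rel 'I_n := fun u v => [set u; v] \in F.

Definition is_P4 F (q : 'I_n * 'I_n * 'I_n * 'I_n) :=
  let: (a, b, c, d) := q in
  [&& edge_adj F a b, edge_adj F b c, edge_adj F c d,
      ~~ edge_adj F a c, ~~ edge_adj F b d & ~~ edge_adj F a d].

Definition has_P4 F := [exists q, is_P4 F q].

Definition simple_edges F := forall e, e \in F -> #|e| = 2.

Lemma edge_adjC F : symmetric (edge_adj F).
Proof. by move=> u v; rewrite /edge_adj setUC. Qed.

Lemma edge_adj_irrefl F : simple_edges F -> irreflexive (edge_adj F).
Proof. by move=> F2 u; apply/negP => /F2; rewrite setUid cards1. Qed.

(** Consecutive vertices differ by irreflexivity; any other two are told apart by a neighbour of
    only one of them. *)
Lemma is_P4_uniq F a b c d : simple_edges F -> is_P4 F (a, b, c, d) -> uniq [:: a; b; c; d].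
Proof.
move=> F2 /and5P[ab bc cd ac /andP[bd ad]].
have ne u v w : edge_adj F u w -> ~~ edge_adj F v w -> u != v.
  by move=> uw; apply: contraNneq => <-.
have irr u v : edge_adj F u v -> u != v.
  by move=> uv; apply/eqP=> uv'; move: uv; rewrite uv' edge_adj_irrefl.
rewrite /= !inE !negb_or (irr _ _ ab) (irr _ _ bc) (irr _ _ cd) !andbT /=.
apply/andP; split; first (apply/andP; split).
- by rewrite eq_sym (ne c a d).
- by rewrite eq_sym (ne d a c) // edge_adjC.
- by rewrite (ne b d a) // edge_adjC.
Qed.

Lemma not_has_P4_no_P4_of_color F : ~~ has_P4 F -> forall b, no_P4_of_color (edge_adj F) b.
Proof.
move=> nP; have nT : no_P4_of_color (edge_adj F) true.
  move=> x y z w _; apply: contra nP; rewrite !eqb_id => /and5P[xy yz zw xz /andP[yw xw]].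
  by apply/existsP; exists (x, y, z, w); rewrite /is_P4 xy yz zw xz yw xw.
by case=> //; apply: (no_P4_of_colorN (edge_adjC F) nT).
Qed.

Definition star v (N : {set 'I_n}) : {set {set 'I_n}} := [set [set v; u] | u in N].

(* A P4-free graph, given by a twin elimination sequence, plus the edges of a star. *)
Definition code := (n.-tuple ('I_n * 'I_n * bool) * 'I_n * {set 'I_n})%type.

Definition graph_of_code (k : code) : {set {set 'I_n}} :=
  [set [set p.1; p.2] | p : 'I_n * 'I_n & twin_graph k.1.1 p.1 p.2] :|: star k.1.2 k.2.

Lemma P4_free_star_code F v N : simple_edges F -> ~~ has_P4 F ->
  exists k, graph_of_code k = F :|: star v N.
Proof.
move=> F2 /not_has_P4_no_P4_of_color nP.
have [l sl El] := P4_free_twin_graph [set: 'I_n] (edge_adjC F) (edge_adj_irrefl F2) nP.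
rewrite cardsT card_ord in sl; exists (tcast sl (in_tuple l), v, N).
rewrite /graph_of_code /= val_tcast /=; congr (_ :|: _); apply/setP=> e.
apply/imsetP/idP => [[[x y]] | eF].
  by rewrite inE /= El // => xy ->.
have /eqP/cards2P[x [y [xy Ee]]] := F2 _ eF.
by exists (x, y); rewrite // inE /= El ?inE // /edge_adj -Ee.
Qed.

Definition below i : {set {set 'I_n}} := [set e : {set 'I_n} | [forall x in e, x < i]].

Lemma edge_adj_below E i u w : edge_adj (E :&: below i) u w = [&& edge_adj E u w, u < i & w < i].
Proof.
rewrite /edge_adj !inE; congr andb; apply/forall_inP/andP => [H|[ui wi] x].
  by split; apply: H; rewrite !inE eqxx ?orbT.
by rewrite !inE => /orP[]/eqP->.
Qed.

Lemma simple_edgesI E F : simple_edges E -> simple_edges (E :&: F).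
Proof. by move=> E2 e; rewrite inE => /andP[/E2]. Qed.

Lemma below_ge E i : n <= i -> E :&: below i = E.
Proof.
move=> ni; apply/setIidPl/subsetP=> e _; rewrite inE; apply/forall_inP=> x _.
exact: leq_trans (ltn_ord x) ni.
Qed.

(** The new vertex [v] contributes only edges at [v], a star; hence a prefix one vertex longer than
    a P4-free one still has a code. *)
Lemma belowS E v : simple_edges E -> E :&: below v.+1 =
  (E :&: below v) :|: star v [set u | [set v; u] \in E :&: below v.+1].
Proof.
move=> E2; apply/setP=> e; apply/idP/idP => [eE|].
  have [ve|ve] := boolP (v \in e).
    have /eqP/cards2P[x [y [xy Ee]]] := simple_edgesI E2 eE.
    have [u Ee'] : exists u, e = [set v; u].
      move: ve; rewrite Ee !inE => /orP[]/eqP->; first by exists y.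
      by exists x; rewrite setUC.
    by apply/setUP; right; apply/imsetP; exists u; rewrite // in_set -Ee'.
  apply/setUP; left; move: eE; rewrite !inE => /andP[-> /forall_inP H] /=.
  apply/forall_inP=> x xe; have := H x xe; rewrite ltnS leq_eqVlt => /orP[/eqP xv|//].
  by move: ve; rewrite -(val_inj xv) xe.
case/setUP => [|/imsetP[u + ->]]; last by rewrite inE.
rewrite !inE => /andP[-> /forall_inP H] /=; apply/forall_inP=> x /H; exact: ltnW.
Qed.

Lemma has_P4_below0 E : ~~ has_P4 (E :&: below 0).
Proof.
by apply/existsPn => -[[[a b] c] d]; apply/negP => /and5P[]; rewrite edge_adj_below ltn0 andbF.
Qed.

Lemma is_P4_below_induced E i a b c d : simple_edges E -> is_P4 (E :&: below i) (a, b, c, d) ->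
  induced_P4 (edge_adj E) [set a; b; c; d].
Proof.
move=> E2 P; have U := is_P4_uniq (simple_edgesI E2) P.
exists a, b, c, d; split=> //.
- have -> : [set a; b; c; d] = [set x in [:: a; b; c; d]].
    by apply/setP=> x; rewrite !inE -!orbA.
  by rewrite cardsE; apply/card_uniqP.
- by case/and5P: P; rewrite !edge_adj_below => /and3P[-> _ _] /and3P[-> _ _] /and3P[-> _ _].
- case/and5P: P; rewrite !edge_adj_below => /and3P[_ -> ->] _ /and3P[_ -> ->].
  by rewrite !andbT => -> /andP[-> ->].
Qed.

Lemma induced_has_P4 E X : induced_P4 (edge_adj E) X -> has_P4 E.
Proof.
move=> [a [b [c [d [_ _ /and3P[ab bc cd] /and3P[ac bd ad]]]]]].
by apply/existsP; exists (a, b, c, d); rewrite /is_P4 ab bc cd ac bd ad.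
Qed.

End EdgeSets.

(** * Binary search for a shortest prefix with an induced path *)

Section BinarySearch.
Variables (n L m : nat).
Hypotheses (n0 : 0 < n) (nL : n < 2 ^ L) (m1 : 1 < m).
Variable sketch : 'I_m -> {set {set 'I_n}}.
Hypothesis sketch_sep : forall k k' : code n,
  (forall j, #|graph_of_code k :&: sketch j| = #|graph_of_code k' :&: sketch j|) ->
  graph_of_code k = graph_of_code k'.

(** The lower end of the search, a prefix length certified P4-free, and the code decoded last. *)
Local Notation data := ('I_(2 ^ L).+1 * code n)%type.

Let d0 : data := (ord0, (nseq_tuple n (Ordinal n0, Ordinal n0, false), Ordinal n0, set0)).

(* Passes [2r] and [2r+1] test whether the graph on the first [target] vertices is P4-free.
   After [2L] passes the truncated subtraction makes [target] one more than [d.1]. *)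
Definition target t (d : data) := d.1 + 2 ^ (L.-1 - t./2).

Definition query t (d : data) (j : 'I_m) : {set {set 'I_n}} :=
  if odd t then if j == 0 :> nat then below n (target t d) else graph_of_code d.2
  else below n (target t d) :&: sketch j.

Definition digest t (d : data) (c : {ffun 'I_m -> nat}) : data :=
  if odd t then
    if [&& [forall j, c j == #|graph_of_code d.2|],
           graph_of_code d.2 \subset below n (target t d) & ~~ has_P4 (graph_of_code d.2)]
    then (inord (target t d), d.2) else d
  else (d.1, odflt d.2 [pick k | [forall j, c j == #|graph_of_code k :&: sketch j|]]).

Definition output (d : data) : option {set 'I_n} :=
  if n <= d.1 then None
  else if [pick q | is_P4 (graph_of_code d.2) q] is Some (x, y, z, w) then Some [set x; y; z; w]
  else None.

Variable s : seq {set 'I_n}.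
Hypothesis vs : valid_stream s.
Let E := [set e in s].

Let E2 : simple_edges E.
Proof. by move=> e; rewrite inE => es; case/andP: vs => /allP/(_ _ es)/eqP. Qed.

Let count_stream (Q : {set {set 'I_n}}) : count (mem Q) s = #|E :&: Q|.
Proof.
case/andP: vs => _ us; rewrite -size_filter -(card_uniqP (filter_uniq _ us)).
by apply: eq_card => e; rewrite !inE mem_filter andbC.
Qed.

Local Notation state := (protocol_state d0 query digest s).

Let stateS t : state t.+1 = digest t (state t) [ffun j => #|E :&: query t (state t) j|].
Proof.
by rewrite /protocol_state iteriS; congr digest; apply/ffunP=> j; rewrite !ffunE count_stream.
Qed.

Let lo_sketch r : (state r.*2.+1).1 = (state r.*2).1.
Proof. by rewrite stateS /digest odd_double. Qed.

(** A code of the prefix matches all counts, and by [sketch_sep] any matching code has the same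
    graph. A prefix without a code may be decoded wrongly, hence the test in the next pass. *)
Lemma state_sketch r : (exists k, graph_of_code k = E :&: below n (target r.*2 (state r.*2))) ->
  graph_of_code (state r.*2.+1).2 = E :&: below n (target r.*2 (state r.*2)).
Proof.
rewrite stateS; move: (state r.*2) => d [k Ek].
rewrite /digest odd_double /=; case: pickP => [k' /forallP Ek'|/(_ k)/negP[]] /=.
  rewrite -Ek; apply: sketch_sep => j.
  by rewrite Ek -(eqP (Ek' j)) ffunE /query odd_double setIA.
by apply/forallP=> j; rewrite ffunE /query odd_double setIA Ek.
Qed.

Lemma state_round r : target r.*2 (state r.*2) <= 2 ^ L ->
  (state r.+1.*2).1 = (if has_P4 (E :&: below n (target r.*2 (state r.*2)))
   then (state r.*2).1 : nat else target r.*2 (state r.*2)) :> nat.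
Proof.
have := @state_sketch r; have := lo_sketch r; rewrite doubleS (stateS r.*2.+1).
move: (state r.*2.+1) (state r.*2) => d d' lo1; set c := target _ _ => Ed tL.
have c1 : target r.*2.+1 d = c by rewrite /c /target lo1 /= uphalf_double doubleK.
have odd1 : odd r.*2.+1 by rewrite /= odd_double.
rewrite /digest odd1 c1; case: ifPn => [/and3P[/forallP H sub nP]|H].
  (* Counter [1] shows that the decoded graph lies in the input, counter [0] that the prefix is no
     larger. *)
  have -> : E :&: below n c = graph_of_code d.2.
    have := H (Ordinal (ltnW m1)); have := H (Ordinal m1).
    rewrite !ffunE /query odd1 /= c1 => /eqP h1 /eqP h0.
    have /eqP Eg : E :&: graph_of_code d.2 == graph_of_code d.2.
      by rewrite eqEcard subsetIr h1 leqnn.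
    by apply/esym/eqP; rewrite eqEcard h0 leqnn andbT subsetI sub -{1}Eg subsetIl.
  by rewrite (negbTE nP) /= inordK.
case: ifPn => [_|nP]; first by rewrite lo1.
(* A P4-free prefix has a code with empty star, so it was decoded exactly and the test cannot
   fail. *)
have [k Ek] := P4_free_star_code (Ordinal n0) set0 (simple_edgesI E2) nP.
have {}Ed : graph_of_code d.2 = E :&: below n c.
  by apply: Ed; exists k; rewrite Ek /star imset0 setU0.
case/negP: H; rewrite Ed nP subsetIr !andbT; apply/forallP=> j.
by rewrite ffunE /query odd1 c1 Ed; case: ifP; rewrite // setIA setIid.
Qed.

(** Each round halves the interval. Its upper end is the initial [2 ^ L], about which no path is
    claimed, or the length of a prefix with an induced path. *)
Lemma binary_search_invariant r : r <= L ->
  let lo := (state r.*2).1 in let hi := lo + 2 ^ (L - r) in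
  [/\ ~~ has_P4 (E :&: below n lo), hi <= 2 ^ L &
      hi = 2 ^ L \/ has_P4 (E :&: below n hi)].
Proof.
elim: r => [_|r IH rL] /=.
  by rewrite subn0 add0n; split; [exact: has_P4_below0 | | left].
have [nP hiL hi] := IH (ltnW rL); set lo := (state r.*2).1 in nP hiL hi.
have Et : target r.*2 (state r.*2) = lo + 2 ^ (L - r.+1).
  by rewrite /target doubleK (_ : L.-1 - r = L - r.+1) //; lia.
have E2' : 2 ^ (L - r) = 2 ^ (L - r.+1) + 2 ^ (L - r.+1).
  by rewrite addnn -mul2n -expnS subnSK.
have := @state_round r; rewrite Et => -> ; last by lia.
rewrite -/lo; case: ifP => P; first by split=> //; [lia | right].
by rewrite -addnA -E2' P; split.
Qed.

Lemma output_correct : match output (state L.*2.+1) with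
  | Some X => induced_P4 (stream_adj s) X
  | None => forall X, ~ induced_P4 (stream_adj s) X end.
Proof.
have adjE X : induced_P4 (stream_adj s) X <-> induced_P4 (edge_adj E) X.
  have ext u v : edge_adj E u v = stream_adj s u v by rewrite /edge_adj inE.
  by split=> -[a [b [c [d H]]]]; exists a, b, c, d; move: H; rewrite !ext.
have [nP _ hi] := binary_search_invariant (leqnn L).
rewrite subnn expn0 addn1 in hi.
rewrite /output lo_sketch; set lo := (state L.*2).1 in nP hi *.
case: (leqP n lo) => nlo.
  by move=> X /adjE/induced_has_P4; rewrite (below_ge _ nlo) in nP; apply/negP.
(* As [lo.+1 <= n < 2 ^ L], the upper end is no longer the initial one. *)
have {}hi : has_P4 (E :&: below n lo.+1) by case: hi => //; lia.
have Et : target L.*2 (state L.*2) = lo.+1.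
  by rewrite /target doubleK (_ : L.-1 - L = 0) ?addn1 //; lia.
have Eg : graph_of_code (state L.*2.+1).2 = E :&: below n lo.+1.
  have [k Ek] := P4_free_star_code (Ordinal nlo)
    [set u | [set Ordinal nlo; u] \in E :&: below n lo.+1] (simple_edgesI E2) nP.
  by rewrite state_sketch Et //; exists k; rewrite Ek; apply/esym; exact: (belowS (Ordinal nlo) E2).
rewrite Eg; case: pickP => [[[[a b] c] d] P|none].
  by apply/adjE; apply: is_P4_below_induced E2 P.
by case/existsP: hi => q; rewrite none.
Qed.

End BinarySearch.

(** * Bounds on passes and space *)

Theorem theorem27 :
  exists (p : nat -> nat) (C k N : nat),
    forall n, N <= n ->
      p n <= C * (trunc_log 2 n) ^ 2 /\
      Dspace_IndSub_P4_le n (p n) (C * n * (trunc_log 2 n) ^ k).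
Proof.
(* The search takes [2 * L] passes and the final decoding one. The memory takes at most
   [34 * L ^ 2 * n] bits, and [L <= 2 * l] turns [34] into [136]. *)
exists (fun n => (trunc_log 2 n).+1.*2.+1), 136, 2, 2 => n n2.
set l := trunc_log 2 n; set L := l.+1.
have n0 : 0 < n by lia.
have l0 : 0 < l by rewrite trunc_log_gt0 n2.
have nL : n < 2 ^ L by apply: trunc_log_ltn.
split; first by rewrite /L; nia.
(* There are at most [2 ^ (10 * L * n)] pairs of codes, so this [m] suffices for
   [separating_family]. *)
set m := 12 * L * n.
have cT : #|{: n.-tuple ('I_n * 'I_n * bool)}| <= 2 ^ (L.*2.+1 * n).
  rewrite card_tuple !card_prod card_ord card_bool expnM leq_exp2r //.
  by rewrite expnS -addnn expnD mulnC leq_mul2l /= leq_mul // ltnW.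
have cC : #|{: code n}| <= 2 ^ (5 * L * n).
  have cS : #|{set 'I_n}| <= 2 ^ n.
    rewrite -[in 2 ^ n](card_ord n) -(cardsT 'I_n) -card_powerset.
    by apply/subset_leq_card/subsetP=> B _; rewrite powersetE subsetT.
  rewrite !card_prod card_ord.
  apply: (@leq_trans (2 ^ (L.*2.+1 * n) * 2 ^ L * 2 ^ n)).
    by rewrite !leq_mul // ltnW.
  by rewrite -!expnD leq_exp2l // /L; nia.
have [|Q HQ] := separating_family (@graph_of_code n) (m := m).
  apply: (@leq_ltn_trans ((2 ^ (5 * L * n)) ^ 2)); first by rewrite leq_exp2r.
  by rewrite -expnM ltn_exp2l // /m /L; nia.
have m1 : 1 < m by rewrite /m /L; nia.
apply: Dspace_of_protocol => [||s vs]; [by [] | | exact: (output_correct n0 nL m1 HQ vs)].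
rewrite card_prod card_ord.
apply: (@leq_trans (2 ^ L.*2.+1 * (2 ^ L.+1 * 2 ^ (5 * L * n)) * (2 ^ L.*2) ^ m)).
  apply: leq_mul; first apply: leq_mul; last 1 first.
  - rewrite leq_exp2r; last by lia.
    by rewrite -addnn expnD mulnn ltn_sqr.
  - exact: ltnW (ltn_expl _ _).
  - by apply: leq_mul => //; rewrite expnS mul2n -addnn -add1n leq_add2r expn_gt0.
rewrite -expnM -!expnD leq_exp2l // /m.
have : L * L <= 4 * l ^ 2 by rewrite /L; nia.
have : 0 < L by []. nia.
Qed.
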